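(* Let $\Omega\subset\mathbb{R}^n$ be a non-empty open set, let $M=(M_p)_{p\in\mathbb{Z}_+}$ and $N=(N_p)_{p\in\mathbb{Z}_+}$ be sequences of positive real numbers, and let $\Gamma,\Lambda$ be regular Newton polyhedra in $\mathbb{R}^n$ with vertices in $\mathbb{Z}_+^n$. Assume that the pairs $(M,\Gamma)$ and $(N,\Lambda)$ satisfy the non-quasianalyticity conditions described in the context. If $N\prec M$ and $\Gamma\subset\Lambda$, then $$\mathcal{D}^{N,\Lambda}(\Omega)\subset\mathcal{D}^{M,\Gamma}(\Omega).$$
   Context: $\mathbb{Z}_+=\{0,1,2,\dots\}$, $\mathbb{R}_+^n=\{x\in\mathbb{R}^n: x_j>0,\ j=1,\dots,n\}$, and $\overline{\mathbb{R}_+^n}$ is its closure. A Newton polyhedron is the convex hull of $\{0\}\cup A$, where $A$ is a finite subset of $\overline{\mathbb{R}_+^n}$. To a Newton polyhedron $\Gamma$ is associated a finite set $\mathcal{A}(\Gamma)\subset\mathbb{R}^n\setminus\{0\}$ with $\Gamma=\bigcap_{q\in\mathcal{A}(\Gamma)}\{\alpha\in\overline{\mathbb{R}_+^n}:\alpha\cdot q\le 1\}$; $\Gamma$ is regular if every $q\in\mathcal{A}(\Gamma)$ has all components $q_j>0$. For regular $\Gamma$, $\mathcal{V}(\Gamma)=\{v^0=0,v^1,\dots,v^\sigma\}$ is its set of vertices and $\gamma(\Gamma)=\max_{v\in\mathcal{V}(\Gamma)}|v|$, with $|v|=v_1+\dots+v_n$, is its maximal order. Space $\mathcal{E}^{M,\Gamma}(\Omega)$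 (for $\Gamma$ with vertices in $\mathbb{Z}_+^n$): for $k=(k_1,\dots,k_\sigma)\in\mathbb{Z}_+^\sigma$ put $\partial_\Gamma^k=\partial^{k_1v^1}\cdots\partial^{k_\sigma v^\sigma}$ (nonzero vertices $v^1,\dots,v^\sigma$) and $|k|=k_1+\dots+k_\sigma$. Then $\mathcal{E}^{M,\Gamma}(\Omega)$ is the set of $u\in C^\infty(\Omega)$ such that for every compact $H\subset\Omega$ there is $C>0$ with $\|\partial_\Gamma^k u\|_{L^\infty(H)}\le C^{|k|+1}M_{|k|}$ for all $k\in\mathbb{Z}_+^\sigma$. $\mathcal{D}^{M,\Gamma}(\Omega):=\mathcal{E}^{M,\Gamma}(\Omega)\cap\mathcal{E}'(\Omega)$, i.e. the elements of $\mathcal{E}^{M,\Gamma}(\Omega)$ with compact support in $\Omega$. Non-quasianalyticity conditions for a pair $(M,\Gamma)$: $M_pM_q\le M_0M_{p+q}$ for all $p,q\in\mathbb{Z}_+$; there exist $A,H>0$ with $M_{p+q}\le AH^{p+q}M_pM_q$ for all $p,q\in\mathbb{Z}_+$; and $\sum_{p=1}^\infty\bigl(M_{p-1}/M_p\bigr)^{1/\gamma(\Gamma)}<+\infty$. $N\prec M$ means that there exist $A>0$, $C>0$ such that $N_p\le CA^pM_p$ for all $p\in\mathbb{Z}_+$. *)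

(* Defs.v *)
From HB Require Import structures.
From mathcomp Require Import all_boot all_order all_algebra.
From mathcomp Require Import finmap complex.
From mathcomp Require Import all_classical all_reals all_analysis.
Import numFieldNormedType.Exports.

Set Implicit Arguments.
Unset Strict Implicit.
Unset Printing Implicit Defensive.

Import Order.TTheory GRing.Theory Num.Theory.

Local Open Scope classical_set_scope.
Local Open Scope ring_scope.
Local Open Scope complex_scope.

Section NewtonPolyhedra.
Context {R : realType} {n : nat}.
Implicit Types (G Q : set 'rV[R]_n) (x v q : 'rV[R]_n).

Definition open_orthant : set 'rV[R]_n := [set x | forall j, 0 < x 0 j].

Definition dot x q : R := \sum_j x 0 j * q 0 j.

Definition newton_polyhedron G := exists A : set 'rV[R]_n,
  [/\ finite_set A, A `<=` closure open_orthant
    & G = smallest (@convex_set R 'rV[R]_n) ([set 0] `|` A)].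

(* Q is a possible choice of the finite set A(G) attached to G.  Such a Q may
   contain redundant elements, so it is not unique: G is regular when some
   choice has only positive components, which amounts to positivity for the
   irredundant choice. *)
Definition normal_set G Q :=
  [/\ finite_set Q, Q `<=` [set q | q != 0]
    & G = \bigcap_(q in Q) [set x | closure open_orthant x /\ dot x q <= 1]].

Definition regular_polyhedron G :=
  newton_polyhedron G /\ exists2 Q, normal_set G Q & Q `<=` open_orthant.

(* The vertices of a polytope are its extreme points. *)
Definition vertices G : set 'rV[R]_n :=
  [set v | G v /\ forall x y (t : R), G x -> G y -> 0 < t < 1 ->
                    v = t *: x + (1 - t) *: y -> x = y].

Definition integral_vertices G :=
  forall v, vertices G v -> forall j, v 0 j \is a Num.nat.

(* vertices G is finite when G is a Newton polyhedron; fset_set returns the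
   empty fset on infinite sets. *)
Definition nzvertices G : {fset 'rV[R]_n} := fset_set (vertices G `\ 0).

Definition max_order G : R :=
  \big[Num.max/0]_(v <- fset_set (vertices G)) \sum_j v 0 j.

End NewtonPolyhedra.

Section Derivatives.
Context {R : realType} {n : nat}.
Implicit Types (u f : 'rV[R]_n -> R[i]) (O : set 'rV[R]_n).

(* Functions are total on R^n; all notions below depend only on the
   restriction of u to the open set O under consideration. *)

(* The j-th partial derivative, taken on the real and imaginary parts. *)
Definition pderiv (j : 'I_n) f : 'rV[R]_n -> R[i] := fun x =>
  ('D_(delta_mx 0 j) (fun y => complex.Re (f y)) x)
  +i* ('D_(delta_mx 0 j) (fun y => complex.Im (f y)) x).

Definition mderiv (a : 'I_n -> nat) u : 'rV[R]_n -> R[i] :=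
  foldr (fun j f => iter (a j) (pderiv j) f) u (enum 'I_n).

Definition C1_part_at (g : 'rV[R]_n -> R) (x : 'rV[R]_n) :=
  {for x, continuous g} /\ forall j : 'I_n, derivable g x (delta_mx 0 j).

(* Partial derivatives of all orders, in any order of differentiation, exist
   and are continuous on O. *)
Definition smooth_on O u := forall (s : seq 'I_n) x, O x ->
  C1_part_at (fun y => complex.Re (foldr pderiv u s y)) x /\
  C1_part_at (fun y => complex.Im (foldr pderiv u s y)) x.

(* Support in O, i.e. closure relative to O. *)
Definition support_in O u : set 'rV[R]_n :=
  O `&` closure [set x | O x /\ u x != 0].

End Derivatives.

Section Linfty.
Context {R : realType} {n : nat}.

Definition box (a b : 'rV[R]_n) : set 'rV[R]_n :=
  [set x | forall j, a 0 j <= x 0 j <= b 0 j].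

(* Sets of n-dimensional Lebesgue (outer) measure zero.  Meant for n > 0:
   for n = 0 the boxes have volume 1 and no set is null. *)
Definition lebesgue_null (A : set 'rV[R]_n) := forall e : R, 0 < e ->
  exists a b : nat -> 'rV[R]_n,
    [/\ forall k j, a k 0 j <= b k 0 j,
        A `<=` \bigcup_k box (a k) (b k)
      & (\sum_(0 <= k <oo) (\prod_j (b k 0 j - a k 0 j))%:E <= e%:E)%E].

(* Essential supremum of |f| over H. *)
Definition Linfty_norm (H : set 'rV[R]_n) (f : 'rV[R]_n -> R[i]) : \bar R :=
  ereal_inf [set c%:E | c in
    [set c : R | 0 <= c /\
      lebesgue_null [set x | H x /\ c < Normc.normc (f x)]]].

End Linfty.

Section Spaces.
Context {R : realType} {n : nat}.
Implicit Types (M N : nat -> R) (G O : set 'rV[R]_n).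

Definition multi_index (x : 'rV[R]_n) : 'I_n -> nat :=
  fun j => Num.truncn (x 0 j).

(* A multi-index k in Z_+^sigma is a function on the sigma nonzero vertices. *)
Definition vderiv G (k : {ffun nzvertices G -> nat}) (u : 'rV[R]_n -> R[i]) :=
  foldr (fun v f => mderiv (multi_index (val v *+ k v)) f) u
        (enum {: nzvertices G}).

Definition vlength G (k : {ffun nzvertices G -> nat}) : nat := (\sum_v k v)%N.

Definition E_space M G O : set ('rV[R]_n -> R[i]) := [set u |
  smooth_on O u /\
  forall H : set 'rV[R]_n, compact H -> H `<=` O ->
    exists2 C : R, 0 < C &
      forall k : {ffun nzvertices G -> nat},
        (Linfty_norm H (vderiv k u)
           <= (C ^+ (vlength k).+1 * M (vlength k))%:E)%E].

Definition D_space M G O : set ('rV[R]_n -> R[i]) :=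
  E_space M G O `&` [set u | compact (support_in O u)].

Definition non_quasianalytic M G :=
  [/\ forall p q, M p * M q <= M 0%N * M (p + q)%N,
      exists A H : R, [/\ 0 < A, 0 < H &
        forall p q, M (p + q)%N <= A * H ^+ (p + q)%N * M p * M q]
    & (\sum_(1 <= p <oo) ((M p.-1 / M p) `^ (max_order G)^-1)%:E < +oo)%E].

Definition prec N M := exists A C : R, [/\ 0 < A, 0 < C &
  forall p, N p <= C * A ^+ p * M p].

End Spaces.

(* Main.v *)
(* A derivative of order sum_v k_v v along the vertices v of Gamma is a
   combination sum_w t_w w of the vertices of Lambda with real t_w >= 0 and
   sum_w t_w <= |k|.  Rounding t_w up to m_w = floor t_w + 1 only raises the
   order in each variable.  Since u has compact support, the mean value theorem
   along a segment leaving the support bounds a derivative by the derivative of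
   higher order, up to a factor geometric in the number of added
   differentiations.  The shift |m| <= |k| + sigma in the index of N costs only
   a geometric factor, by the two product inequalities satisfied by N. *)

Require Import Defs.
From mathcomp Require Import all_boot all_order all_algebra.
From mathcomp Require Import finmap complex lra ring.
From mathcomp Require Import all_classical all_reals all_analysis.
From mathcomp Require Import measurable_realfun.
Import numFieldNormedType.Exports.

Set Implicit Arguments.
Unset Strict Implicit.
Unset Printing Implicit Defensive.

Import Order.TTheory GRing.Theory Num.Theory.

Local Open Scope classical_set_scope.
Local Open Scope ring_scope.

Section ExtremePoints.
Context {R : realType} {n : nat}.
Implicit Types (L : set 'rV[R]_n) (S : seq 'rV[R]_n).

(* The convex hull of 0 and S: the missing weight sits on 0. *)
Definition subhull S : set 'rV[R]_n := [set x | exists c : 'rV[R]_n -> R,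
  [/\ forall s, 0 <= c s, \sum_(s <- S) c s <= 1
    & x = \sum_(s <- S) c s *: s]].

Lemma subhull_convex S : @convex_set R 'rV[R]_n (subhull S).
Proof.
move=> x y l /set_mem[c [c0 c1 ->]] /set_mem[d [d0 d1 ->]]; apply/mem_set.
exists (fun s => l%:num * c s + (1 - l%:num) * d s).
have l0 : 0 <= l%:num by [].
have l1 : 0 <= 1 - l%:num by rewrite subr_ge0.
split.
- by move=> s; rewrite addr_ge0 ?mulr_ge0.
- rewrite big_split /= -!mulr_sumr -[leRHS](subrKC l%:num).
  by apply: lerD; exact: ler_piMr.
- have -> : \sum_(s <- S) (l%:num * c s + (1 - l%:num) * d s) *: s =
      l%:num *: (\sum_(s <- S) c s *: s) +
      (1 - l%:num) *: (\sum_(s <- S) d s *: s) :> 'rV[R]_n; last by [].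
  rewrite !scaler_sumr -big_split /=.
  by apply: eq_bigr => s _; rewrite scalerDl !scalerA.
Qed.

Lemma newton_polyhedron_hull L : newton_polyhedron L -> exists S,
  [/\ uniq S, forall s, s \in S -> L s & L `<=` subhull S].
Proof.
move=> [A [Afin _ ->]]; exists (enum_fset (fset_set A)).
have SA s : (s \in fset_set A) = (s \in A) by rewrite in_fset_set.
split; first exact: fset_uniq.
- move=> s; rewrite -[_ \in _]/(s \in fset_set A) SA => /set_mem As.
  by apply: sub_gen_smallest; right.
- apply: smallest_sub; first exact: subhull_convex.
  move=> x [->|Ax].
    by exists (fun=> 0); rewrite !big1// => s _; rewrite scale0r.
  exists (fun s => (s == x)%:R).
  have xA : x \in enum_fset (fset_set A).
    by rewrite -[_ \in _]/(x \in fset_set A) SA inE.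
  split=> [s||]; first by case: eqP.
    rewrite (bigD1_seq x)//= ?fset_uniq// eqxx big1 ?addr0// => i ix.
    by rewrite (negPf ix).
  rewrite (bigD1_seq x)//= ?fset_uniq// eqxx scale1r big1 ?addr0// => i ix.
  by rewrite (negPf ix) scale0r.
Qed.

Lemma newton_polyhedron_convex L x y (t : R) : newton_polyhedron L ->
  L x -> L y -> 0 <= t <= 1 -> L (t *: x + (1 - t) *: y).
Proof.
move=> [A [_ _ ->]] Lx Ly /andP[t0 t1] C [convC AC].
have t01 : Itv.spec (@Itv.num_sem R) (Itv.Real `[0%Z, 1%Z]) t.
  by rewrite /Itv.spec /Itv.num_sem/= in_itv/= t0 t1 ger0_real.
by have /set_mem := convC x y (Itv.mk t01) (mem_set (Lx C (conj convC AC)))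
  (mem_set (Ly C (conj convC AC))).
Qed.

Lemma newton_polyhedron0 L : newton_polyhedron L -> L 0.
Proof. by move=> [A [_ _ ->]]; apply: sub_gen_smallest; left. Qed.

Lemma comb_eq0 S (c : 'rV[R]_n -> R) : (forall s, 0 <= c s) ->
  \sum_(s <- S) c s <= 0 -> \sum_(s <- S) c s *: s = 0.
Proof.
move=> c0 cS; have /eqP : \sum_(s <- S) c s = 0.
  by apply/eqP; rewrite eq_le cS sumr_ge0.
rewrite psumr_eq0// => /allP cS0.
by rewrite big_seq big1// => s /cS0 /= /eqP ->; rewrite scale0r.
Qed.

Lemma subhull_sub L S : newton_polyhedron L -> (forall s, s \in S -> L s) ->
  subhull S `<=` L.
Proof.
move=> Lnp; elim: S => [|s S IH] SL x [c [c0 c1 ->]].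
  by rewrite big_nil; exact: newton_polyhedron0.
have Ls : L s by apply: SL; rewrite mem_head.
have {}IH := IH (fun u uS => SL u (@mem_behead _ (s :: S) u uS)).
rewrite big_cons in c1; rewrite big_cons.
have S0 : 0 <= \sum_(i <- S) c i by apply: sumr_ge0.
have [cs1|cs1] := eqVneq (c s) 1.
  by rewrite comb_eq0// ?addr0 ?cs1 ?scale1r//; lra.
have cs : 0 < 1 - c s by move: cs1; rewrite neq_lt => /orP[]; lra.
have -> : \sum_(j <- S) c j *: j =
    (1 - c s) *: \sum_(j <- S) (c j / (1 - c s)) *: j.
  rewrite scaler_sumr; apply: eq_bigr => j _.
  by rewrite scalerA mulrCA divff ?mulr1// gt_eqF.
apply: newton_polyhedron_convex => //; last by rewrite c0; lra.
apply: IH; exists (fun j => c j / (1 - c s)); split=> //.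
  by move=> j; rewrite divr_ge0// ltW.
by rewrite -mulr_suml ler_pdivrMr//; lra.
Qed.

Lemma vertex_subhull L S v : newton_polyhedron L ->
  (forall s, s \in S -> L s) -> vertices L v -> subhull S v ->
  v = 0 \/ v \in S.
Proof.
move=> Lnp + [_ vext]; elim: S => [|s S IH] SL [c [c0 c1 ve]].
  by left; rewrite ve big_nil.
have Ls : L s by apply: SL; rewrite mem_head.
have SL' u : u \in S -> L u by move=> uS; apply: SL; rewrite inE uS orbT.
rewrite big_cons in c1; rewrite big_cons in ve.
have S0 : 0 <= \sum_(i <- S) c i by apply: sumr_ge0.
have [cs1|cs1] := eqVneq (c s) 1.
  right; rewrite ve comb_eq0// ?addr0 ?cs1 ?scale1r ?mem_head//; lra.
have cs : 0 < 1 - c s by move: cs1; rewrite neq_lt => /orP[]; lra.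
have [cs0|cs0] := eqVneq (c s) 0.
  have [|->|vS] := IH SL'; [|by left|by right; rewrite inE vS orbT].
  by exists c; split=> //; [lra|rewrite ve cs0 scale0r add0r].
have {}cs0 : 0 < c s by rewrite lt_def cs0 c0.
pose y := \sum_(j <- S) (c j / (1 - c s)) *: j.
have ve' : v = c s *: s + (1 - c s) *: y.
  rewrite ve; congr (_ + _); rewrite scaler_sumr; apply: eq_bigr => j _.
  by rewrite scalerA mulrCA divff ?mulr1// gt_eqF.
right; have -> : v = s; last by rewrite mem_head.
rewrite ve' -(vext s y (c s))//.
- by rewrite -scalerDl subrKC scale1r.
- apply: (@subhull_sub L S) => //; exists (fun j => c j / (1 - c s)).
  split=> //; first by move=> j; rewrite divr_ge0// ltW.
  by rewrite -mulr_suml ler_pdivrMr//; lra.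
- by rewrite cs0; lra.
Qed.

Lemma subhull_perm S S' : perm_eq S S' -> subhull S `<=` subhull S'.
Proof.
move=> SS' x [c [c0 c1 ->]]; exists c; rewrite -(perm_big _ SS').
by split=> //; rewrite -(perm_big _ SS').
Qed.

Lemma subhull_absorb s S : subhull S s -> subhull (s :: S) `<=` subhull S.
Proof.
move=> [e [e0 e1 se]] x [c [c0]]; rewrite !big_cons => c1 ->.
exists (fun i => c s * e i + c i); split=> [i||].
- by rewrite addr_ge0 ?mulr_ge0.
- rewrite big_split/= -mulr_sumr; apply: le_trans c1.
  by rewrite lerD2r ler_piMr.
- rewrite {2}se scaler_sumr -big_split/=; apply: eq_bigr => i _.
  by rewrite scalerDl scalerA.
Qed.

Lemma non_vertex_subhull L s S : L `<=` subhull (s :: S) -> L s ->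
  ~ vertices L s -> subhull S s.
Proof.
move=> LS Ls nvs.
have [x [y [t [Lx Ly /andP[t0 t1] se xy]]]] : exists x y (t : R),
    [/\ L x, L y, 0 < t < 1, s = t *: x + (1 - t) *: y & x <> y].
  apply: contrapT => H; apply: nvs; split=> // x y t Lx Ly t01 se.
  by apply: contrapT => xy; apply: H; exists x, y, t.
have [c [c0]] := LS _ Lx; have [d [d0]] := LS _ Ly.
rewrite !big_cons => d1 ye c1 xe.
have C0 : 0 <= \sum_(i <- S) c i by apply: sumr_ge0.
have D0 : 0 <= \sum_(i <- S) d i by apply: sumr_ge0.
pose w := 1 - t * c s - (1 - t) * d s.
pose z := t *: \sum_(j <- S) c j *: j + (1 - t) *: \sum_(j <- S) d j *: j.
have wz : w *: s = z.
  move: se; rewrite /z {1}xe {1}ye.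
  move: (\sum_(j <- S) _) (\sum_(j <- S) _) => X Y /rowP se.
  by apply/rowP => j; move: (se j); rewrite /w !mxE => se'; nra.
have w0 : 0 < w.
  have : 0 <= w by rewrite /w; nra.
  rewrite le_eqVlt => /orP[/eqP w0|//]; exfalso; apply: xy.
  have tc : 0 <= t * (1 - c s) by apply: mulr_ge0; lra.
  have td : 0 <= (1 - t) * (1 - d s) by apply: mulr_ge0; lra.
  have cs : c s = 1.
    have /eqP : t * (1 - c s) = 0 by move: w0; rewrite /w; lra.
    by rewrite mulf_eq0 => /orP[] /eqP; lra.
  have ds : d s = 1.
    have /eqP : (1 - t) * (1 - d s) = 0 by move: w0; rewrite /w; lra.
    by rewrite mulf_eq0 => /orP[] /eqP; lra.
  by rewrite xe ye cs ds !comb_eq0//; lra.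
exists (fun i => (t * c i + (1 - t) * d i) / w); split=> [i||].
- apply: divr_ge0; last exact: ltW.
  by apply: addr_ge0; apply: mulr_ge0 => //; lra.
- by rewrite -mulr_suml big_split/= -!mulr_sumr ler_pdivrMr// /w; nra.
- transitivity (w^-1 *: z); first by rewrite -wz scalerA mulVf ?scale1r ?gt_eqF.
  rewrite /z !scaler_sumr -big_split/= scaler_sumr; apply: eq_bigr => i _.
  by rewrite !scalerA -scalerDl scalerA mulrC.
Qed.

Lemma newton_polyhedron_vertices L : newton_polyhedron L -> exists S,
  [/\ uniq S, forall s, s \in S -> (vertices L `\ 0) s & L `<=` subhull S].
Proof.
move=> Lnp; have [S0 [uS0 SL0 LS0]] := newton_polyhedron_hull Lnp.
have [m] := ubnP (size S0).
elim: m S0 uS0 SL0 LS0 => // m IH S uS SL LS; rewrite ltnS => Sm.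
have [allv|/existsNP[s /not_implyP[sS nvs]]] :=
  pselect (forall s, s \in S -> (vertices L `\ 0) s); first by exists S.
have LS' : L `<=` subhull (s :: rem s S).
  by apply: (subset_trans LS); apply: subhull_perm; exact: perm_to_rem.
apply: (IH (rem s S)).
- exact: rem_uniq.
- by move=> u /mem_rem; exact: SL.
- apply: (subset_trans LS'); apply: subhull_absorb.
  have [->|s0] := pselect (s = 0).
    exists (fun=> 0); split=> //; first by rewrite big1.
    by rewrite big1// => i _; rewrite scale0r.
  apply: (non_vertex_subhull LS') => [|vs]; first exact: SL.
  exact: nvs.
- by rewrite size_rem// (leq_trans _ Sm)// prednK//; case: (S) sS.
Qed.

Lemma nzvertices_mem L v : newton_polyhedron L ->
  (v \in nzvertices L) = (v \in vertices L `\ 0).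
Proof.
move=> Lnp; rewrite in_fset_set//.
have [S [_ SL LS]] := newton_polyhedron_vertices Lnp.
apply: (@sub_finite_set _ _ [set` S]); last exact: finite_seq.
move=> w [vw w0] /=.
have SL' s : s \in S -> L s by move=> /SL[[]].
by have [/w0|] := vertex_subhull Lnp SL' vw (LS _ (proj1 vw)).
Qed.

Lemma nzvertices_hull L x : newton_polyhedron L -> L x ->
  exists c : 'rV[R]_n -> R,
  [/\ forall s, 0 <= c s, \sum_(w : nzvertices L) c (val w) <= 1
    & x = \sum_(w : nzvertices L) c (val w) *: val w].
Proof.
move=> Lnp Lx; have [S [uS SL LS]] := newton_polyhedron_vertices Lnp.
have [c [c0 c1 xe]] := LS _ Lx; exists c.
have pS : perm_eq (enum_fset (nzvertices L)) S.
  apply: (uniq_perm (fset_uniq _)) => // v.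
  rewrite -[LHS]/(v \in nzvertices L) nzvertices_mem//.
  apply/idP/idP => [/set_mem[vv v0]|/SL/mem_set//].
  have SL' s : s \in S -> L s by move=> /SL[[]].
  by have [/v0|] := vertex_subhull Lnp SL' vv (LS _ (proj1 vv)).
split=> //.
  by rewrite -(perm_big _ pS) big_seq_fsetE in c1.
by rewrite xe -(perm_big _ pS) big_seq_fsetE.
Qed.

End ExtremePoints.
Section BoxesAreNotNull.
Context {R : realType}.

Lemma interval_cover_length (a b q : nat -> R) (c d : R) :
  c < d -> (forall k, a k <= b k) -> (forall k, 0 <= q k) ->
  (forall t, c <= t <= d ->
    (1 <= \sum_(0 <= k <oo) (q k * (a k <= t <= b k)%R%:R)%:E)%E) ->
  ((d - c)%:E <= \sum_(0 <= k <oo) (q k * (b k - a k))%:E)%E.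
Proof.
move=> cd ab q0 cover.
pose J : set R := [set` `[c, d]]; pose I k : set R := [set` `[a k, b k]].
pose f k (t : R) : \bar R := ((q k)%:E * (\1_(I k) t)%:E)%E.
have f0 k t : (0 <= f k t)%E by rewrite mule_ge0 ?lee_fin ?q0.
have mJ : measurable J by exact: measurable_itv.
have mI k : measurable (I k) by exact: measurable_itv.
have m1 k : measurable_fun J (EFin \o (\1_(I k) : R -> R)).
  by apply/measurable_EFinP; exact: measurable_indic.
have mf k : measurable_fun J (f k).
  by apply: emeasurable_funM; [exact: measurable_cst|exact: m1].
have muJ : lebesgue_measure J = (d - c)%:E.
  by rewrite lebesgue_measure_itv/= lte_fin cd.
have intf k : (\int[lebesgue_measure]_(t in J) f k t <=
    (q k * (b k - a k))%:E)%E.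
  rewrite /f ge0_integralZl_EFin//; last exact: m1.
  rewrite integral_indic; [|exact: mJ|exact: mI].
  rewrite EFinM.
  apply: lee_wpmul2l; first by rewrite lee_fin.
  apply: (@le_trans _ _ (lebesgue_measure (I k))).
    apply: le_measure; rewrite ?inE; last exact: subIsetl.
      exact: measurableI (mI k) mJ.
    exact: mI.
  rewrite lebesgue_measure_itv/= lte_fin.
  by case: ltP => // _; rewrite lee_fin subr_ge0.
rewrite -muJ -[leLHS]mul1e -integral_cst//.
apply: le_trans (lee_nneseries _ (fun k _ => intf k)); last first.
  by move=> k _ _; apply: integral_ge0 => t _; exact: f0.
rewrite -integral_nneseries//; apply: ge0_le_integral => //.
  exact: (ge0_emeasurable_sum (P := xpredT) (fun k t _ _ => f0 k t)
    (fun k _ => mf k)).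
move=> t tJ; apply: le_trans (cover t _) _.
  by move: tJ; rewrite /J/= in_itv.
apply: lee_nneseries => [k _ _|k _]; first by rewrite lee_fin mulr_ge0.
by rewrite /f /I indicE EFinM mem_setE in_itv.
Qed.

(* Coordinates are integrated out one at a time: each step turns the indicator
   of one side into its relative length, absorbed in the weights. *)
Lemma box_cover_volume (n : nat) (a b : nat -> 'I_n -> R) (c d : 'I_n -> R)
    (s : seq 'I_n) (w : nat -> R) :
  (forall j, c j < d j) -> (forall k j, a k j <= b k j) ->
  (forall k, 0 <= w k) -> uniq s ->
  (forall x : 'I_n -> R, (forall j, c j <= x j <= d j) ->
    (1 <= \sum_(0 <= k <oo)
       (w k * \prod_(j <- s) (a k j <= x j <= b k j)%R%:R)%:E)%E) ->
  (1 <= \sum_(0 <= k <oo)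
     (w k * \prod_(j <- s) ((b k j - a k j) / (d j - c j)))%:E)%E.
Proof.
move=> cd ab; elim: s w => [|i s IH] w w0 /= => [_ cover|].
  have := cover c; under eq_eseriesr do rewrite big_nil.
  move=> /(_ _)/le_trans; apply=> [j|]; first by rewrite lexx ltW.
  by under [leRHS]eq_eseriesr do rewrite big_nil.
move=> /andP[i_s us] cover.
have dc j : 0 < d j - c j by rewrite subr_gt0.
under eq_eseriesr do rewrite big_cons mulrA.
apply: IH => // [k|x xcd].
  by rewrite mulr_ge0// divr_ge0 ?subr_ge0// ltW.
pose q k := w k * \prod_(j <- s) (a k j <= x j <= b k j)%R%:R.
have q0 k : 0 <= q k by rewrite mulr_ge0// prodr_ge0.
have := @interval_cover_length (a^~ i) (b^~ i) q (c i) (d i) (cd i) (ab^~ i) q0.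
move=> /(_ _)/wrap[t tcd|].
  have /cover : forall j, c j <= (if j == i then t else x j) <= d j.
    by move=> j; case: eqP => [->|].
  move=> /le_trans; apply; apply: lee_nneseries => k.
    by move=> _ _; rewrite lee_fin mulr_ge0// prodr_ge0.
  move=> _; rewrite lee_fin big_cons eqxx /q -mulrA ler_wpM2l//.
  rewrite mulrC ler_wpM2r// big_seq [leRHS]big_seq.
  rewrite le_eqVlt; apply/orP; left; apply/eqP; apply: eq_bigr => j js.
  by case: eqP js i_s => [-> ->|].
rewrite -(@lee_pmul2l _ ((d i - c i)^-1)%:E)// ?lte_fin ?invr_gt0//.
rewrite -EFinM mulVf ?gt_eqF// -nneseriesZl => [/le_trans|k _]; last first.
  by rewrite lee_fin mulr_ge0 ?subr_ge0.
apply; apply: lee_nneseries => [k _ _|k _].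
  rewrite -EFinM lee_fin mulr_ge0 ?invr_ge0 ?(ltW (dc i))//.
  by rewrite mulr_ge0 ?subr_ge0.
rewrite -EFinM lee_fin le_eqVlt; apply/orP; left; apply/eqP.
by rewrite /q; ring.
Qed.

Lemma lebesgue_null_not_nbhs (n : nat) (A : set 'rV[R]_n) (x : 'rV[R]_n) :
  lebesgue_null A -> ~ nbhs x A.
Proof.
move=> Anull /nbhs_ballP[e /= e0 xA].
pose c j := x 0 j - e / 2; pose d j := x 0 j + e / 2.
have cd j : c j < d j by rewrite /c /d; lra.
have [] := Anull (e ^+ n / 2); first by rewrite divr_gt0// exprn_gt0.
move=> a [b [ab Acover vol]].
have := @box_cover_volume n (fun k j => a k 0 j) (fun k j => b k 0 j) c d
  (enum 'I_n) (fun=> 1) cd ab (fun=> ler01) (enum_uniq _).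
have dc j : d j - c j = e by rewrite /c /d; lra.
move=> /(_ _)/wrap[y ycd|].
  have [k _ yk] : (\bigcup_k box (a k) (b k)) (\row_j y j).
    apply/Acover/xA; split=> // i j; rewrite !mxE -ball_normE/= (ord1 i).
    by have := ycd j; rewrite /c /d ltr_norml; lra.
  rewrite (nneseriesD1 (n := k))// => [|i _]; last first.
    by rewrite lee_fin mulr_ge0// prodr_ge0.
  rewrite big1 ?mulr1 => [|j _]; last by have := yk j; rewrite mxE => ->.
  rewrite leeDl// nneseries_ge0// => i _ _.
  by rewrite lee_fin mulr_ge0// prodr_ge0.
apply/negP; rewrite -ltNge.
have -> : (\sum_(0 <= k <oo)
    (1 * \prod_(j <- enum 'I_n) ((b k 0 j - a k 0 j) / (d j - c j)))%:E =
    (e ^- n)%:E * \sum_(0 <= k <oo) (\prod_j (b k 0 j - a k 0 j))%:E)%E.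
  rewrite -nneseriesZl => [|k _]; last first.
    by rewrite lee_fin prodr_ge0// => j _; rewrite subr_ge0.
  apply: eq_eseriesr => k _; rewrite mul1r -EFinM; congr EFin.
  rewrite big_enum/=; under eq_bigr do rewrite dc.
  by rewrite big_split/= prodr_const card_ord mulrC exprVn.
apply: (@le_lt_trans _ _ ((e ^- n)%:E * (e ^+ n / 2)%:E)%E).
  by rewrite lee_wpmul2l// lee_fin invr_ge0 exprn_ge0 ?ltW.
by rewrite -EFinM lte_fin mulrA mulVf ?expf_neq0 ?gt_eqF// mul1r; lra.
Qed.

End BoxesAreNotNull.
Section PartialDerivatives.
Context {R : realType} {n : nat}.
Implicit Types (g h : 'rV[R]_n -> R) (O K : set 'rV[R]_n) (s t : seq 'I_n).

Definition rpderiv (j : 'I_n) g : 'rV[R]_n -> R :=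
  fun x => 'D_(delta_mx 0 j) g x.

Definition rsmooth_on O g :=
  forall s x, O x -> C1_part_at (foldr rpderiv g s) x.

Lemma foldr_rpderiv_eq O g h s : open O -> (forall x, O x -> g x = h x) ->
  forall x, O x -> foldr rpderiv g s x = foldr rpderiv h s x.
Proof.
move=> openO gh; elim: s => [|j s IH] x Ox /=; first exact: gh.
apply: near_eq_derive; near=> y; apply: IH.
by near: y; exact: open_nbhs_nbhs.
Unshelve. all: by end_near. Qed.

Lemma C1_part_at_near g h x : (\near x, g x = h x) ->
  C1_part_at g x -> C1_part_at h x.
Proof.
move=> gh [gc gd]; split=> [|j]; last exact: near_eq_derivable (gd j).
have gx : g x = h x := nbhs_singleton gh.
rewrite /prop_for /continuous_at -gx; apply: cvg_trans gc.
exact: (@near_eq_cvg _ _ (nbhs x) _ g h gh).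
Qed.

Lemma rsmooth_on_eq O g h : open O -> (forall x, O x -> g x = h x) ->
  rsmooth_on O g -> rsmooth_on O h.
Proof.
move=> openO gh gs s x Ox; apply: C1_part_at_near (gs s x Ox).
near=> y; apply: (foldr_rpderiv_eq _ openO gh).
by near: y; exact: open_nbhs_nbhs.
Unshelve. all: by end_near. Qed.

Lemma is_derive_line g x (v : 'rV[R]_n) (a : R) : derivable g (x + a *: v) v ->
  is_derive a 1 (fun b : R => g (x + b *: v)) ('D_v g (x + a *: v)).
Proof.
move=> dg.
have E : (fun b : R => b^-1 *: (g (x + (b *: 1 + a) *: v) - g (x + a *: v))) =
         (fun b : R => b^-1 *: (g (b *: v + (x + a *: v)) - g (x + a *: v))).
  apply/funext => b; congr (_ *: (g _ - _)).
  by rewrite [b *: 1]mulr1 scalerDl addrCA.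
by apply: DeriveDef; rewrite /derivable /derive /= E.
Qed.

Lemma is_derive_shift g x w (v : 'rV[R]_n) : derivable g (x + w) v ->
  is_derive x v (fun y => g (y + w)) ('D_v g (x + w)).
Proof.
move=> dg.
have E : (fun b : R => b^-1 *: (g (b *: v + x + w) - g (x + w))) =
         (fun b : R => b^-1 *: (g (b *: v + (x + w)) - g (x + w))).
  by apply/funext => b; rewrite addrA.
by apply: DeriveDef; rewrite /derivable /derive /= E.
Qed.

Lemma MVT_line g x (v : 'rV[R]_n) (a : R) : 0 < a ->
  (forall b, 0 <= b <= a -> derivable g (x + b *: v) v) ->
  exists2 b, 0 < b < a & g (x + a *: v) - g x = 'D_v g (x + b *: v) * a.
Proof.
move=> a0 dg; have [||b b0a] := @MVT R (fun b : R => g (x + b *: v))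
    (fun b : R => 'D_v g (x + b *: v)) 0 a a0.
- move=> b; rewrite in_itv/= => /andP[b0 ba].
  by apply/is_derive_line/dg; rewrite !ltW.
- apply: derivable_within_continuous => b; rewrite in_itv/= => b0a.
  by have [] := is_derive_line (dg b b0a).
by rewrite scale0r addr0 subr0; exists b; first by rewrite in_itv in b0a.
Qed.

Lemma second_difference O g x (i j : 'I_n) (a : R) :
  let e k := delta_mx 0 k : 'rV[R]_n in 0 < a ->
  (forall p q, 0 <= p <= a -> 0 <= q <= a -> O (x + p *: e i + q *: e j)) ->
  (forall y k, O y -> derivable g y (e k)) ->
  (forall y k l, O y -> derivable (rpderiv k g) y (e l)) ->
  exists p q, [/\ 0 < p < a, 0 < q < a &
    g (x + a *: e i + a *: e j) - g (x + a *: e i) - (g (x + a *: e j) - g x) =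
    rpderiv j (rpderiv i g) (x + p *: e i + q *: e j) * a ^+ 2].
Proof.
move=> e a0 xO dg ddg.
have aa : 0 <= a <= a by apply/andP; split=> //; exact: ltW.
have a00 : 0 <= (0 : R) <= a by apply/andP; split=> //; exact: ltW.
pose f y := g (y + a *: e j) - g y.
have df p : 0 <= p <= a ->
    is_derive (x + p *: e i) (e i) f
    (rpderiv i g (x + p *: e i + a *: e j) - rpderiv i g (x + p *: e i)).
  move=> p0a.
  have Op q : 0 <= q <= a -> O (x + p *: e i + q *: e j) by exact: xO.
  apply: is_deriveB; first by apply: is_derive_shift; apply/dg/Op.
  by apply/derivableP/dg; have := Op 0 a00; rewrite scale0r addr0.
have [|p /andP[p0 pa]] := @MVT_line f x (e i) a a0.
  by move=> b b0a; have [] := df b b0a.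
have p0a : 0 <= p <= a by rewrite !ltW.
have [_ ->] := df p p0a.
have [|q /andP[q0 qa] ->] := @MVT_line (rpderiv i g) (x + p *: e i) (e j) a a0.
  by move=> b b0a; apply: ddg; apply: xO.
rewrite /f => fE; exists p, q; rewrite p0 pa q0 qa; split=> //.
by rewrite fE expr2 mulrA.
Qed.

Lemma rpderiv_comm O g x i j : open O -> rsmooth_on O g -> O x ->
  rpderiv i (rpderiv j g) x = rpderiv j (rpderiv i g) x.
Proof.
move=> openO gs Ox; apply/eqP; rewrite -subr_eq0 -normr_le0.
apply/ler_addgt0Pr => e e0; rewrite add0r.
have tri (u v w : R) : `|v - u| < e / 2 -> `|w - u| < e / 2 -> `|w - v| <= e.
  by rewrite !ltr_norml ler_norml; lra.
have cij k l : \forall y \near x, `|rpderiv k (rpderiv l g) x -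
    rpderiv k (rpderiv l g) y| < e / 2.
  have [c _] := gs [:: k; l] x Ox.
  by move/cvgrPdist_lt : c; apply; rewrite divr_gt0.
have : nbhs x (O `&`
    ([set y | `|rpderiv i (rpderiv j g) x - rpderiv i (rpderiv j g) y| < e / 2]
    `&`
    [set y | `|rpderiv j (rpderiv i g) x - rpderiv j (rpderiv i g) y| < e / 2])).
  exact: filterI (open_nbhs_nbhs (conj openO Ox)) (filterI (cij i j) (cij j i)).
move=> /nbhs_ballP[d /= d0 xd].
pose a := d / 3; have a0 : 0 < a by rewrite divr_gt0.
have ball_x k l p q : 0 <= p <= a -> 0 <= q <= a ->
    ball x d (x + p *: delta_mx 0 k + q *: delta_mx 0 l).
  move=> /andP[p0 pa] /andP[q0 qa]; split=> // o m.
  rewrite -ball_normE/= !mxE -addrA opprD addNKr normrN.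
  apply: le_lt_trans (ler_normD _ _) _.
  have H (b : bool) (u : R) : 0 <= u -> `|u * b%:R| <= u.
    by move=> u0; case: b; rewrite ?mulr1 ?mulr0 ?normr0// ger0_norm.
  apply: (@le_lt_trans _ _ (p + q)); first by rewrite lerD ?H.
  by rewrite /a in pa qa; lra.
have dg y k : O y -> derivable g y (delta_mx 0 k).
  by move=> Oy; have [_] := gs [::] y Oy.
have ddg y k l : O y -> derivable (rpderiv k g) y (delta_mx 0 l).
  by move=> Oy; have [_] := gs [:: k] y Oy.
have xO k l p q p0 q0 := proj1 (xd _ (ball_x k l p q p0 q0)).
have [p [q [p0 q0 E1]]] := second_difference a0 (xO i j) dg ddg.
have [p' [q' [p0' q0' E2]]] := second_difference a0 (xO j i) dg ddg.
have W (u : R) : 0 < u < a -> 0 <= u <= a by move=> /andP[u0 ua]; rewrite !ltW.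
have [_ [_ B1]] := xd _ (ball_x i j p q (W _ p0) (W _ q0)).
have [_ [B2 _]] := xd _ (ball_x j i p' q' (W _ p0') (W _ q0')).
have E : rpderiv j (rpderiv i g) (x + p *: delta_mx 0 i + q *: delta_mx 0 j) =
    rpderiv i (rpderiv j g) (x + p' *: delta_mx 0 j + q' *: delta_mx 0 i).
  have sub4C (A B C D : R) : A - B - (C - D) = A - C - (B - D) by ring.
  have a20 : a ^+ 2 != 0 by rewrite expf_neq0// gt_eqF.
  apply: (mulIf a20); apply: etrans (esym E1) _; apply: etrans _ E2.
  by rewrite sub4C [x + _ *: delta_mx 0 j + _]addrAC.
move: B1 => /=; rewrite E => B1; exact: tri B1 B2.
Qed.

Lemma rsmooth_on_foldr O g s : rsmooth_on O g ->
  rsmooth_on O (foldr rpderiv g s).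
Proof. by move=> gs t x Ox; rewrite -foldr_cat; exact: gs. Qed.

Lemma foldr_rpderiv_perm O g s t : open O -> rsmooth_on O g -> perm_eq s t ->
  forall x, O x -> foldr rpderiv g s x = foldr rpderiv g t x.
Proof.
move=> openO gs; elim: s t => [|j s IH] t.
  by rewrite perm_sym => /perm_nilP ->.
move=> st; have jt : j \in t by rewrite -(perm_mem st) mem_head.
case/splitPr: jt st => t1 t2 st.
have {}st : perm_eq s (t1 ++ t2).
  rewrite -(perm_cons j); apply: (perm_trans st).
  by rewrite perm_catC/= perm_cons perm_catC.
move=> x Ox; transitivity (foldr rpderiv g (j :: t1 ++ t2) x).
  by rewrite /=; apply: near_eq_derive; near=> y; apply: IH => //;
     near: y; exact: open_nbhs_nbhs.
elim: t1 x Ox {st} => [//|k t1 IHt] x Ox; rewrite [RHS]/= [X in X x = _]/=.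
rewrite (@rpderiv_comm O) //; last exact: rsmooth_on_foldr.
by apply: near_eq_derive; near=> y; apply: IHt; near: y; exact: open_nbhs_nbhs.
Unshelve. all: by end_near. Qed.

Lemma foldr_rpderiv_eq0 O g s : open O -> (forall x, O x -> g x = 0) ->
  forall x, O x -> foldr rpderiv g s x = 0.
Proof.
move=> openO g0 x Ox; rewrite (@foldr_rpderiv_eq O g (cst 0))//.
elim: s {g g0} x {Ox} => [//|j s IH] x /=.
rewrite /rpderiv (_ : foldr _ _ _ = cst 0) ?derive_cst//.
by apply/funext => y; exact: IH.
Qed.

Lemma rpderiv_bound K g (r c : R) j : 
  (forall x, K x -> forall k, `|x 0 k| <= r) -> (forall x, ~ K x -> g x = 0) ->
  (forall x, derivable g x (delta_mx 0 j)) ->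
  (forall x, `|rpderiv j g x| <= c) -> 0 <= r ->
  forall x, `|g x| <= (2 * r + 1) * c.
Proof.
move=> Kr g0 dg gc r0 x.
have c0 : 0 <= c by exact: le_trans (gc x).
have r1 : 0 < 2 * r + 1 by lra.
have [Kx|Kx] := pselect (K x); last by rewrite g0// normr0 mulr_ge0// ltW.
have [b _] := MVT_line r1 (fun b _ => dg (x + b *: delta_mx 0 j)).
rewrite (g0 (x + _)).
  move=> /(congr1 Num.norm); rewrite sub0r normrN normrM (gtr0_norm r1) => ->.
  by rewrite mulrC; apply: ler_wpM2l; [exact: ltW|exact: gc].
move=> /Kr /(_ j); have := Kr x Kx j.
by rewrite !mxE !eqxx /= mulr1 !ler_norml; lra.
Qed.

Lemma foldr_rpderiv_bound K g (r c : R) s t : closed K ->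
  (forall x, K x -> forall k, `|x 0 k| <= r) -> (forall x, ~ K x -> g x = 0) ->
  rsmooth_on setT g -> (forall x, `|foldr rpderiv g (t ++ s) x| <= c) ->
  0 <= r ->
  forall x, `|foldr rpderiv g s x| <= (2 * r + 1) ^+ size t * c.
Proof.
move=> clK Kr g0 gs + r0; elim: t c => [|j t IH] c gc x.
  by rewrite mul1r.
rewrite /= exprSr -mulrA; apply: IH => y.
apply: (@rpderiv_bound K _ _ _ j) => //.
- by apply: (foldr_rpderiv_eq0 _ (O := ~` K)) => //; exact: closed_openC.
- by move=> z; have [_] := gs (t ++ s) z I.
Qed.

End PartialDerivatives.
Section DerivativeSequences.
Context {R : realType} {n : nat}.
Implicit Types (u : 'rV[R]_n -> R[i]) (s t : seq 'I_n) (G : set 'rV[R]_n).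

Lemma Re_foldr_pderiv u s : (fun y => complex.Re (foldr pderiv u s y)) =
  foldr rpderiv (fun y => complex.Re (u y)) s.
Proof. by elim: s => [//|j s /= ->]. Qed.

Lemma Im_foldr_pderiv u s : (fun y => complex.Im (foldr pderiv u s y)) =
  foldr rpderiv (fun y => complex.Im (u y)) s.
Proof. by elim: s => [//|j s /= ->]. Qed.

Definition index_seq (a : 'I_n -> nat) : seq 'I_n :=
  flatten [seq nseq (a j) j | j <- enum 'I_n].

Lemma count_index_seq (a : 'I_n -> nat) j : count_mem j (index_seq a) = a j.
Proof.
rewrite count_flatten sumnE 2!big_map big_enum/= (bigD1 j)//= count_nseq/= eqxx.
by rewrite mul1n big1 ?addn0// => i ij; rewrite count_nseq/= (negPf ij).
Qed.

Lemma mderiv_foldr (a : 'I_n -> nat) u :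
  mderiv a u = foldr pderiv u (index_seq a).
Proof.
rewrite /mderiv /index_seq; elim: (enum _) => [//|j s IH] /=.
by rewrite foldr_cat -IH; elim: (a j) => [//|m /= ->].
Qed.

Definition vertex_seq G (k : {ffun nzvertices G -> nat}) : seq 'I_n :=
  flatten [seq index_seq (multi_index (val v *+ k v))
             | v <- enum {: nzvertices G}].

Lemma vderiv_foldr G (k : {ffun nzvertices G -> nat}) u :
  vderiv k u = foldr pderiv u (vertex_seq k).
Proof.
rewrite /vderiv /vertex_seq; elim: (enum _) => [//|v s /= ->].
by rewrite foldr_cat mderiv_foldr.
Qed.

Lemma multi_indexMn G v k j : newton_polyhedron G -> integral_vertices G ->
  v \in nzvertices G -> multi_index (v *+ k) j = (k * multi_index v j)%N.
Proof.
move=> Gnp Gint; rewrite nzvertices_mem// => /set_mem[vG _].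
rewrite /multi_index mulmxnE; have /natrP[m ->] := Gint v vG j.
by rewrite -mulrnA !natrK mulnC.
Qed.

Lemma multi_indexK G v j : newton_polyhedron G -> integral_vertices G ->
  v \in nzvertices G -> (multi_index v j)%:R = v 0 j.
Proof.
move=> Gnp Gint; rewrite nzvertices_mem// => /set_mem[vG _].
by rewrite /multi_index; have /natrP[m ->] := Gint v vG j; rewrite natrK.
Qed.

Lemma count_vertex_seq G (k : {ffun nzvertices G -> nat}) j :
  newton_polyhedron G -> integral_vertices G ->
  count_mem j (vertex_seq k) = (\sum_v k v * multi_index (val v) j)%N.
Proof.
move=> Gnp Gint; rewrite count_flatten sumnE 2!big_map big_enum/=.
apply: eq_bigr => v _; rewrite count_index_seq (@multi_indexMn G)//.
Qed.

Lemma size_count_mem s : size s = (\sum_j count_mem j s)%N.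
Proof.
elim: s => [|j s IH] /=; first by rewrite big1.
rewrite big_split/= -IH (bigD1 j)//= eqxx big1 ?addn0// => i ij.
by rewrite eq_sym (negPf ij).
Qed.

Lemma size_vertex_seq G : newton_polyhedron G -> integral_vertices G ->
  exists W, forall k : {ffun nzvertices G -> nat},
    (size (vertex_seq k) <= W * vlength k)%N.
Proof.
move=> Gnp Gint.
exists (\sum_(v : nzvertices G) \sum_j multi_index (val v) j)%N.
move=> k; rewrite size_count_mem.
under eq_bigr do rewrite count_vertex_seq//.
rewrite exchange_big/= /vlength big_distrr/=; apply: leq_sum => v _.
rewrite -big_distrr/= mulnC leq_mul2r; apply/orP; right.
by rewrite [leqRHS](bigD1 v)//= leq_addr.
Qed.

Lemma perm_extension s t : (forall j, count_mem j s <= count_mem j t)%N ->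
  exists r, perm_eq (r ++ s) t.
Proof.
move=> st; exists (index_seq (fun j => count_mem j t - count_mem j s)%N).
apply/allP => j _ /=; rewrite count_cat.
by rewrite [X in (X + _)%N](count_index_seq _ j) subnK.
Qed.

Lemma vertex_domination G L (k : {ffun nzvertices G -> nat}) :
  newton_polyhedron G -> newton_polyhedron L ->
  integral_vertices G -> integral_vertices L -> G `<=` L ->
  exists m : {ffun nzvertices L -> nat},
    (vlength m <= vlength k + #|{: nzvertices L}|)%N /\
    forall j, (count_mem j (vertex_seq k) <= count_mem j (vertex_seq m))%N.
Proof.
move=> Gnp Lnp Gint Lint GL.
have /choice[c cP] : forall v : nzvertices G, exists c : 'rV[R]_n -> R,
    [/\ forall x, 0 <= c x, \sum_(w : nzvertices L) c (val w) <= 1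
      & val v = \sum_(w : nzvertices L) c (val w) *: val w].
  move=> v; apply: nzvertices_hull => //; apply: GL.
  by have := valP v; rewrite nzvertices_mem// => /set_mem[[]].
pose t (w : nzvertices L) := \sum_v (k v)%:R * c v (val w).
have c0 v x : 0 <= c v x by have [] := cP v.
have t0 w : 0 <= t w by apply: sumr_ge0 => v _; apply: mulr_ge0.
exists [ffun w => (Num.truncn (t w)).+1]; split=> [|j].
  rewrite /vlength; under eq_bigr do rewrite ffunE -addn1.
  rewrite big_split/= sum1_card leq_add2r -(ler_nat R) !natr_sum.
  apply: (@le_trans _ _ (\sum_w t w)).
    by apply: ler_sum => w _; rewrite truncn_le t0.
  rewrite /t exchange_big/=; apply: ler_sum => v _.
  by rewrite -mulr_sumr ler_piMr//; have [] := cP v.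
rewrite !count_vertex_seq// -(ler_nat R) !natr_sum.
have -> : \sum_(v : nzvertices G) (k v * multi_index (val v) j)%:R =
    \sum_w t w * (val w : 'rV[R]_n) 0 j.
  under [RHS]eq_bigr do rewrite /t mulr_suml.
  rewrite exchange_big/=; apply: eq_bigr => v _.
  rewrite natrM (@multi_indexK G)//.
  have [_ _ ->] := cP v; rewrite summxE mulr_sumr.
  by apply: eq_bigr => w _; rewrite !mxE mulrA.
apply: ler_sum => w _; rewrite natrM (multi_indexK j Lnp Lint (valP w)).
rewrite ffunE ler_wpM2r//; last exact: ltW (truncnS_gt _).
by rewrite -(multi_indexK j Lnp Lint (valP w)).
Qed.

End DerivativeSequences.
Section SupNorm.
Context {R : realType} {n : nat}.
Implicit Types (f u : 'rV[R]_n -> R[i]) (g : 'rV[R]_n -> R).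
Implicit Types (O K : set 'rV[R]_n) (s t : seq 'I_n).

Lemma normc_ge_Re (z : R[i]) : `|complex.Re z| <= Normc.normc z.
Proof.
case: z => a b /=; rewrite -sqrtr_sqr ler_wsqrtr// lerDl; exact: sqr_ge0.
Qed.

Lemma normc_ge_Im (z : R[i]) : `|complex.Im z| <= Normc.normc z.
Proof.
case: z => a b /=; rewrite -sqrtr_sqr ler_wsqrtr// lerDr; exact: sqr_ge0.
Qed.

Lemma normc_le_ReIm (z : R[i]) :
  Normc.normc z <= `|complex.Re z| + `|complex.Im z|.
Proof.
case: z => a b /=; have ab : 0 <= `|a| * `|b| by [].
rewrite -[leRHS]ger0_norm ?addr_ge0// -sqrtr_sqr ler_wsqrtr// sqrrD.
by rewrite !real_normK ?num_real//; lra.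
Qed.

Lemma Linfty_norm_le (H : set 'rV[R]_n) f (c : R) : (0 < n)%N -> 0 <= c ->
  (forall x, H x -> Normc.normc (f x) <= c) -> (Linfty_norm H f <= c%:E)%E.
Proof.
move=> n0 c0 fc; apply: ereal_inf_lbound; exists c => //; split=> // e e0.
exists (fun=> 0), (fun=> 0); split=> //.
  by move=> x [/fc]; rewrite leNgt => /negP.
rewrite eseries0 ?lee_fin ?ltW// => k _ _.
by rewrite (bigD1 (Ordinal n0))//= subrr mul0r.
Qed.

Lemma Linfty_norm_pointwise O K f (c : R) : open O ->
  (forall x, O x -> {for x, continuous (fun y => complex.Re (f y))}) ->
  (forall x, O x -> {for x, continuous (fun y => complex.Im (f y))}) ->
  (forall x, O x -> ~ K x -> f x = 0) -> (Linfty_norm K f <= c%:E)%E ->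
  forall x, O x -> Normc.normc (f x) <= c.
Proof.
move=> openO fRe fIm f0 fc x Ox; rewrite leNgt; apply/negP => cx.
have : (Linfty_norm K f < (Normc.normc (f x))%:E)%E by exact: le_lt_trans fc _.
move=> /ereal_inf_lt[_ [d [d0 dnull] <-]]; rewrite lte_fin => dx.
apply: (lebesgue_null_not_nbhs (x := x) dnull).
pose sq y := complex.Re (f y) ^+ 2 + complex.Im (f y) ^+ 2.
have normE y : Normc.normc (f y) = Num.sqrt (sq y) by rewrite /sq; case: (f y).
have sqc : (fun y => Normc.normc (f y)) @ x --> Normc.normc (f x).
  rewrite normE; under eq_fun do rewrite normE.
  have sqx : {for x, continuous sq}.
    exact: (cvgD (cvgM (fRe x Ox) (fRe x Ox)) (cvgM (fIm x Ox) (fIm x Ox))).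
  exact: (continuous_comp sqx (@sqrt_continuous _ _)).
have : \forall y \near x, d < Normc.normc (f y).
  exact: (cvgr_gt _ sqc _ dx).
have : \forall y \near x, O y by exact: open_nbhs_nbhs.
apply: filterS2 => y Oy dy; split=> //.
apply: contrapT => Ky; move: dy; rewrite normE /sq f0// /=.
by rewrite expr0n addr0 sqrtr0 ltNge d0.
Qed.

Lemma derivative_bound O K g (r c : R) s t : open O -> closed K ->
  (forall x, K x -> forall k, `|x 0 k| <= r) -> 0 <= r ->
  (forall x, O x -> ~ K x -> g x = 0) -> K `<=` O -> 
  rsmooth_on O g -> 0 <= c ->
  (forall x, O x -> `|foldr rpderiv g (t ++ s) x| <= c) ->
  forall x, O x -> `|foldr rpderiv g s x| <= (2 * r + 1) ^+ size t * c.
Proof.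
move=> openO clK Kr r0 g0 KO gs c0 gc x Ox.
pose g' y := if `[< O y >] then g y else 0.
have gg' y : O y -> g y = g' y by move=> Oy; rewrite /g' asboolT.
have g'0 y : ~ K y -> g' y = 0.
  by move=> Ky; rewrite /g'; case: asboolP => // Oy; exact: g0.
have openKC : open (~` K) by exact: closed_openC.
have g's : rsmooth_on setT g'.
  move=> l y _; have [Oy|Oy] := pselect (O y).
    exact: (rsmooth_on_eq openO gg' gs).
  have Ky : (~` K) y by move=> /KO.
  apply: (@rsmooth_on_eq _ _ (~` K) (cst 0)) => // [z Kz|m z _].
    by rewrite g'0.
  have -> : foldr rpderiv (cst 0) m = cst (0 : R).
    by apply/funext => w; apply: (foldr_rpderiv_eq0 _ openT).
  by split=> [|j]; [exact: cst_continuous|exact: derivable_cst].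
rewrite (foldr_rpderiv_eq _ openO gg')//.
apply: (foldr_rpderiv_bound clK Kr g'0 g's _ r0) => y.
have [Oy|Oy] := pselect (O y).
  by rewrite -(foldr_rpderiv_eq _ openO gg')// gc.
by rewrite (foldr_rpderiv_eq0 _ openKC g'0) ?normr0// => /KO.
Qed.

Lemma compact_coord_bound K : compact K ->
  exists2 r : R, 0 <= r & forall x, K x -> forall k, `|x 0 k| <= r.
Proof.
move=> /compact_bounded[M [Mreal KM]].
exists (`|M| + 1) => [|x Kx k]; first by rewrite addr_ge0.
apply: le_trans (KM (`|M| + 1) _ x Kx).
  have -> : `|x| = mx_norm x by [].
  by rewrite mx_normrE; exact: (le_bigmax _ (fun i => `|x i.1 i.2|) (0, k)).
by rewrite (le_lt_trans (ler_norm _))// ltrDl.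
Qed.

End SupNorm.

Lemma weight_absorption (R : realType) (M N : nat -> R) (C D : R)
    (W sigma : nat) :
  (forall p, 0 < M p) -> (forall p, 0 < N p) -> 0 < C -> 1 <= D ->
  (forall p q, N p * N q <= N 0%N * N (p + q)%N) ->
  (exists A H : R, [/\ 0 < A, 0 < H &
     forall p q, N (p + q)%N <= A * H ^+ (p + q)%N * N p * N q]) ->
  prec N M ->
  exists2 E : R, 0 < E & forall p q r, (q <= p + sigma)%N -> (r <= W * q)%N ->
    2 * (D ^+ r * (C ^+ q.+1 * N q)) <= E ^+ p.+1 * M p.
Proof.
move=> M0 N0 C0 D1 Nlog [A [H [A0 H0 Nmul]]] [A2 [C2 [A20 C20 NM]]].
pose C1 := C + 1; pose B := N 0%N / N 1%N + 1.
have C11 : 1 <= C1 by rewrite /C1; lra.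
have B1 : 1 <= B by rewrite lerDr divr_ge0 ?ltW.
have N_step p : N p <= B * N p.+1.
  have : N p <= N 0%N / N 1%N * N p.+1.
    by rewrite mulrAC ler_pdivlMr//; have := Nlog p 1%N; rewrite addn1.
  by move=> /le_trans; apply; rewrite ler_wpM2r ?ltW// ltrDl.
have N_le p i : N p <= B ^+ i * N (p + i)%N.
  elim: i => [|i IH]; first by rewrite mul1r addn0.
  apply: (le_trans IH); rewrite exprSr -mulrA addnS ler_wpM2l//.
  by rewrite exprn_ge0; lra.
pose F := D ^+ W * C1 * B * H.
have F0 : 0 < F by rewrite !mulr_gt0 ?exprn_gt0//; lra.
pose E := 2 * F ^+ sigma * C1 * A * N sigma * C2.
have E0 : 0 < E by rewrite !mulr_gt0 ?exprn_gt0//; lra.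
exists (E + F * A2 + 1) => [|p q r qp rq].
  by rewrite !addr_gt0// mulr_gt0.
have FA0 : 0 < F * A2 by rewrite mulr_gt0.
apply: (@le_trans _ _ (E * (F * A2) ^+ p * M p)); last first.
  apply: ler_wpM2r; first exact: ltW.
  rewrite exprS; apply: ler_pM; [exact: ltW|exact/exprn_ge0/ltW|lra|].
  by rewrite lerXn2r ?nnegrE; lra.
pose l := (p + sigma)%N.
have h1 : D ^+ r <= (D ^+ W) ^+ l.
  by rewrite -exprM ler_weXn2l// (leq_trans rq)// leq_mul2l qp orbT.
have h2 : C ^+ q.+1 <= C1 ^+ l * C1.
  rewrite -exprSr; apply: (@le_trans _ _ (C1 ^+ q.+1)).
    by rewrite lerXn2r ?nnegrE /C1; lra.
  by rewrite ler_weXn2l.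
have h3 : N q <= B ^+ l * N l.
  apply: le_trans (N_le q (l - q)%N) _; rewrite subnKC//.
  by apply: ler_wpM2r; [exact: ltW|rewrite ler_weXn2l// leq_subr].
have h4 : N l <= A * H ^+ l * (C2 * A2 ^+ p * M p) * N sigma.
  apply: (le_trans (Nmul p sigma)); apply: ler_wpM2r; first exact: ltW.
  by apply: ler_wpM2l (NM p); apply/ltW/mulr_gt0 => //; exact: exprn_gt0.
have -> : E * (F * A2) ^+ p * M p = 2 * ((D ^+ W) ^+ l * (C1 ^+ l * C1 *
    (B ^+ l * (A * H ^+ l * (C2 * A2 ^+ p * M p) * N sigma)))).
  by rewrite /E /F /l !exprMn !exprD; ring.
have D0 : 0 <= D by lra.
apply: ler_wpM2l => //; apply: ler_pM h1 _; first exact: exprn_ge0.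
  by apply: mulr_ge0; [exact/exprn_ge0/ltW|exact: ltW].
apply: ler_pM h2 _; [exact/exprn_ge0/ltW|exact: ltW|].
apply: (le_trans h3); apply: ler_wpM2l h4.
by apply: exprn_ge0; lra.
Qed.
Theorem proposition37 (R : realType) (n : nat) (n_gt0 : (0 < n)%N)
    (Omega : set 'rV[R]_n) (Omega_open : open Omega)
    (Omega_neq0 : Omega !=set0)
    (M N : nat -> R) (M_gt0 : forall p, 0 < M p) (N_gt0 : forall p, 0 < N p)
    (Gamma Lambda : set 'rV[R]_n)
    (Gamma_regular : regular_polyhedron Gamma)
    (Lambda_regular : regular_polyhedron Lambda)
    (Gamma_integral : integral_vertices Gamma)
    (Lambda_integral : integral_vertices Lambda)
    (MGamma : non_quasianalytic M Gamma)
    (NLambda : non_quasianalytic N Lambda)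
    (NM : prec N M) (GammaLambda : Gamma `<=` Lambda) :
  D_space N Lambda Omega `<=` D_space M Gamma Omega.
Proof.
move=> u [[us uE] uK]; split=> //; split=> // H _ HO.
have Gnp := proj1 Gamma_regular; have Lnp := proj1 Lambda_regular.
pose K := support_in Omega u.
have KO : K `<=` Omega by move=> x [].
have clK : closed K by apply: compact_closed uK; exact: norm_hausdorff.
have u0 x : Omega x -> ~ K x -> u x = 0.
  move=> Ox Kx; apply: contrapT => /eqP ux; apply: Kx; split=> //.
  exact: subset_closure.
have [r r0 Kr] := compact_coord_bound uK.
have [C C0 uC] := uE K uK KO.
have [Nlog Nmul _] := NLambda.
have [W sizeW] := size_vertex_seq Lnp Lambda_integral.
have D1 : 1 <= 2 * r + 1 by lra.
have [E E0 EP] := weight_absorption W #|{: nzvertices Lambda}| M_gt0 N_gt0 C0 D1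
  Nlog Nmul NM.
exists E => // k.
have [m [mk km]] := vertex_domination k Gnp Lnp Gamma_integral Lambda_integral
  GammaLambda.
have [t tk] := perm_extension km.
pose c := C ^+ (vlength m).+1 * N (vlength m).
have c0 : 0 <= c by apply: mulr_ge0; [exact/exprn_ge0/ltW|exact: ltW].
have gRe : rsmooth_on Omega (fun y => complex.Re (u y)).
  by move=> s x Ox; have [+ _] := us s x Ox; rewrite Re_foldr_pderiv.
have gIm : rsmooth_on Omega (fun y => complex.Im (u y)).
  by move=> s x Ox; have [_] := us s x Ox; rewrite Im_foldr_pderiv.
have um x : Omega x -> Normc.normc (vderiv m u x) <= c.
  move: x; apply: (Linfty_norm_pointwise (K := K) Omega_open _ _ _ (uC m)).
  - by move=> x Ox; rewrite vderiv_foldr; have [[]] := us (vertex_seq m) x Ox.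
  - by move=> x Ox; rewrite vderiv_foldr; have [_ []] := us (vertex_seq m) x Ox.
  - move=> x Ox Kx; have openOK : open (Omega `&` ~` K).
      by apply: openI => //; exact: closed_openC.
    have Re0 : complex.Re (vderiv m u x) = 0.
      rewrite vderiv_foldr (congr1 (@^~ x) (Re_foldr_pderiv u _)).
      by apply: (foldr_rpderiv_eq0 _ openOK) => // y [Oy Ky]; rewrite u0.
    have Im0 : complex.Im (vderiv m u x) = 0.
      rewrite vderiv_foldr (congr1 (@^~ x) (Im_foldr_pderiv u _)).
      by apply: (foldr_rpderiv_eq0 _ openOK) => // y [Oy Ky]; rewrite u0.
    by apply/eqP; rewrite eq_complex Re0 Im0 !eqxx.
have bound (part : R[i] -> R) : (forall z, `|part z| <= Normc.normc z) ->
    (forall s, (fun y => part (foldr pderiv u s y)) =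
       foldr rpderiv (fun y => part (u y)) s) ->
    rsmooth_on Omega (fun y => part (u y)) ->
    forall x, H x -> `|part (vderiv k u x)| <= (2 * r + 1) ^+ size t * c.
  move=> part_le partE gs x Hx; rewrite vderiv_foldr.
  have -> : part (foldr pderiv u (vertex_seq k) x) =
      foldr rpderiv (fun y => part (u y)) (vertex_seq k) x by rewrite -partE.
  apply: (derivative_bound Omega_open clK Kr r0 _ KO gs c0 _ (HO _ Hx)).
    move=> y Oy Ky; rewrite u0//; apply/normr0_eq0/le_anti.
    rewrite normr_ge0 andbT (le_trans (part_le 0))// /Normc.normc/=.
    by rewrite expr0n addr0 sqrtr0.
  move=> y Oy; rewrite (foldr_rpderiv_perm Omega_open gs tk Oy) -partE.
  by rewrite -vderiv_foldr; apply: le_trans (part_le _) (um y Oy).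
have D0 : 0 <= 2 * r + 1 by lra.
have B0 : 0 <= (2 * r + 1) ^+ size t * c by rewrite mulr_ge0 ?exprn_ge0.
apply: (@le_trans _ _ (2 * ((2 * r + 1) ^+ size t * c))%:E); last first.
  rewrite lee_fin; apply: EP => //.
  apply: leq_trans (sizeW m); rewrite -(perm_size tk) size_cat; exact: leq_addr.
apply: Linfty_norm_le => //; first by rewrite mulr_ge0.
move=> x Hx; apply: le_trans (normc_le_ReIm _) _.
have := bound (@complex.Re R) (@normc_ge_Re R) (Re_foldr_pderiv u) gRe x Hx.
have := bound (@complex.Im R) (@normc_ge_Im R) (Im_foldr_pderiv u) gIm x Hx.
by move=> *; rewrite mulr_natl mulr2n; apply: lerD.
Qed.
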